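(* Let $\theta \in (0,1]$ be fixed and write $$ \alpha:=W\biggl(\frac{e}{\theta\log 2}\biggr). $$ Let $n \ge 2$ be a squarefree integer. Assume that $\alpha - 1 < \log \omega(n)$ and that $\omega(n) \ge 56$. Then $$ \mathcal{H}_{\theta}(n) \le n\exp\left(-\frac{\theta\log 2}{\alpha}\,\omega(n)\log \omega(n)+\left(\frac{\alpha-1}{1-\frac{\alpha-1}{\log \omega(n)}}\right)^3\frac{\omega(n)}{\exp\left(\frac{\alpha-1}{1+\frac{\alpha-1}{\log \omega(n)}}\right)\log \omega(n)}\right). $$
   Context: $\mu$ is the Möbius function and $\omega(n)$ is the number of distinct prime divisors of $n$. For an integer $n\ge 1$ and real $z$, $M(n,z):=\sum_{d\mid n,\ d\le z}\mu(d)$. For $\theta\in(0,1]$, $$\mathcal{H}_{\theta}(n):=\bigl|\{j \in [1,n] \cap \mathbb{N}:\ |M(n,j)| \ge 2^{\theta\omega(n)}\}\bigr|.$$ The function $W:[e,\infty) \rightarrow [1,\infty)$ is defined implicitly by $\frac{\exp(W(x))}{W(x)}=x$ (the solution that is at least $1$). *)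

(* Defs.v *)
From HB Require Import structures.
From mathcomp Require Export all_boot all_order all_algebra.
From mathcomp Require Export all_classical all_reals all_analysis.
From mathcomp Require Import ring lra.
Export Order.TTheory GRing.Theory Num.Theory.
Export numFieldNormedType.Exports.

Set Implicit Arguments.
Unset Strict Implicit.
Unset Printing Implicit Defensive.

Local Open Scope classical_set_scope.
Local Open Scope ring_scope.

Definition squarefree (n : nat) : bool :=
  (0 < n)%N && all (fun p => ~~ (p ^ 2 %| n)%N) (primes n).

Definition omega (n : nat) : nat := size (primes n).

Definition moebius (n : nat) : int :=
  if squarefree n then (-1) ^+ omega n else 0.

Definition M (R : realType) (n : nat) (z : R) : int :=
  \sum_(d <- divisors n | d%:R <= z) moebius d.

Definition calH (R : realType) (theta : R) (n : nat) : nat :=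
  #|[pred j : 'I_n.+1 | (1 <= j)%N &&
      (2 `^ (theta * (omega n)%:R) <= `|M n (j%:R : R)|%:~R)]|.

(* Only meaningful for [expR 1 <= x], where [W_ge1], [W_eq] and [W_unique]
   show that the set below is a singleton; the default value 1 is junk. *)
Definition W (R : realType) (x : R) : R :=
  xget 1 [set w : R | 1 <= w /\ expR w / w = x].

Lemma W_exists (R : realType) (x : R) : expR 1 <= x ->
  exists w : R, 1 <= w /\ expR w / w = x.
Proof.
move=> ex.
have e1 : 1 + 1 <= expR 1 :> R by exact: expR_ge1Dx.
have b1 : 1 <= 4 * x :> R by lra.
pose f (w : R) := expR w - x * w.
have cf : {within `[1, 4 * x], continuous f}.
  apply: continuous_subspaceT => w.
  apply: cvgB; first exact: continuous_expR.
  by apply: cvgM; [exact: cvg_cst|exact: cvg_id].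
have f1 : f 1 <= 0 by rewrite /f; lra.
have f2 : 0 <= f (4 * x).
  have h : 1 + 2 * x <= expR (2 * x) by exact: expR_ge1Dx.
  have -> : f (4 * x) = expR (2 * x) ^+ 2 - x * (4 * x).
    by rewrite /f expr2 -expRD; congr (expR _ - _); ring.
  nra.
have [|w w_in fw] := IVT b1 cf (v := 0).
  by rewrite ge_min le_max f1 f2 orbT.
move: w_in; rewrite in_itv /= => /andP[w1 _]; exists w; split => //.
have w0 : w != 0 by rewrite gt_eqF//; lra.
by apply: (mulIf w0); rewrite divfK//; rewrite /f in fw; lra.
Qed.

Lemma W_ge1 (R : realType) (x : R) : expR 1 <= x -> 1 <= W x.
Proof.
by move=> /W_exists[w hw]; rewrite /W; case: xgetP => [y _ []//|/(_ w)].
Qed.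

Lemma W_eq (R : realType) (x : R) : expR 1 <= x -> expR (W x) / W x = x.
Proof.
by move=> /W_exists[w hw]; rewrite /W; case: xgetP => [y _ []//|/(_ w)].
Qed.

Lemma W_unique (R : realType) (x w : R) :
  1 <= w -> expR w / w = x -> W x = w.
Proof.
have mono (a b : R) : 1 <= a -> a < b -> expR a / a < expR b / b.
  move=> a1 ab; rewrite ltr_pdivrMr; last by lra.
  rewrite mulrAC ltr_pdivlMr; last by lra.
  have -> : expR b = expR a * expR (b - a) by rewrite -expRD; congr expR; ring.
  rewrite -mulrA ltr_pM2l ?expR_gt0//.
  have h : 1 + (b - a) < expR (b - a) by apply: expR_gt1Dx; lra.
  nra.
move=> w1 wx; rewrite /W; case: xgetP => [y _ [y1 yx]|/(_ w)/=]; last first.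
  by case.
by case: (ltgtP y w) => // [/(mono _ _ y1)|/(mono _ _ w1)];
  rewrite wx yx ltxx.
Qed.

(* Main.v *)
(* Write w = omega n, L = ln w, c = alpha - 1 and x = c / L. As the Moebius
   function sums to 0 over the divisors of n, |M(n, j)| is at most the number
   of divisors of n above j, which Rankin's trick bounds by
   (n / j)^x * \prod_(p | n) (1 + p^-x). Since theta * ln 2 = (1 + c) e^-c, the
   condition |M(n, j)| >= 2^(theta w) then gives the claimed bound on j, hence
   on the number of such j, as soon as \sum_(p | n) p^-x <= w e^-c + x E, where
   e^-c = w^-x and E is the error term of the theorem.
   For x <= 1/3 the sum is at most w^(1 - x): it suffices by concavity to treat
   x = 1/3, which goes by induction on w >= 56, the k-th prime being at least
   27/8 k for k >= 30. For x > 1/3 comparing p_k with k bounds the sum by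
   w^(1 - x) / (1 - x), and x E absorbs the excess because L >= 7/2. *)
Require Import Defs.
From mathcomp Require Import ring lra zify.
Set Implicit Arguments.
Unset Strict Implicit.
Unset Printing Implicit Defensive.
Local Open Scope ring_scope.

(** * Concavity of powers *)

(** Bernoulli's inequality for exponents in [[0, 1]]. With [t = ln x], apply [1 + u <= exp u] at
    [u = (1 - s) t] and at [u = - s t], with weights [s] and [1 - s]; the terms linear in [t]
    cancel. *)
Lemma powR_le_affine (R : realType) (x s : R) :
  0 <= x -> 0 <= s -> s <= 1 -> x `^ s <= 1 + s * (x - 1).
Proof.
move=> x0 s0 s1; have [->|x_neq0] := eqVneq x 0.
  have [->|s_neq0] := eqVneq s 0; first by rewrite powRr0; lra.
  by rewrite powR0//; lra.
have {}x0 : 0 < x by rewrite lt_neqAle eq_sym x_neq0.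
rewrite /powR gt_eqF// -[X in 1 + s * (X - 1)](@lnK _ x)//.
set t := ln x.
have h1 : 1 + (1 - s) * t <= expR ((1 - s) * t) by exact: expR_ge1Dx.
have h2 : 1 - s * t <= expR (- (s * t)) by exact: expR_ge1Dx.
have e0 : 0 < expR (s * t) by exact: expR_gt0.
have e1 : expR t = expR (s * t) * expR ((1 - s) * t).
  by rewrite -expRD; congr expR; ring.
have e2 : expR (s * t) * expR (- (s * t)) = 1 by rewrite -expRD subrr expR0.
have h3 := ler_wpM2l (mulr_ge0 s0 (ltW e0)) h1.
have h4 : (1 - s) * expR (s * t) * (1 - s * t) <=
    (1 - s) * expR (s * t) * expR (- (s * t)).
  by apply: ler_wpM2l h2; rewrite mulr_ge0 ?subr_ge0// ltW.
by rewrite -(mulrA _ _ (expR (- _))) e2 in h4; rewrite e1; lra.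
Qed.

(** * Divisor sums over squarefree numbers *)

Lemma perm_primes_mul (p m : nat) : prime p -> (0 < m)%N -> ~~ (p %| m)%N ->
  perm_eq (primes (p * m)) (p :: primes m).
Proof.
move=> pp m0 pm; apply: uniq_perm; first exact: primes_uniq.
  by rewrite /= primes_uniq mem_primes m0 pp /= pm.
by move=> q; rewrite primesM ?(prime_gt0 pp)// primes_prime// mem_seq1 in_cons.
Qed.

Lemma perm_divisors_mul (p m : nat) : prime p -> (0 < m)%N -> ~~ (p %| m)%N ->
  perm_eq (divisors (p * m)) (divisors m ++ [seq (p * d)%N | d <- divisors m]).
Proof.
move=> pp m0 pm; have p0 := prime_gt0 pp.
have pm0 : (0 < p * m)%N by rewrite muln_gt0 p0.
apply: uniq_perm; first exact: divisors_uniq.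
  rewrite cat_uniq divisors_uniq map_inj_uniq ?divisors_uniq ?andbT.
    apply/hasPn => _ /mapP[d _ ->]; rewrite -dvdn_divisors//.
    by apply: contra pm; apply: dvdn_trans; rewrite dvdn_mulr.
  by move=> a b /eqP; rewrite eqn_pmul2l// => /eqP.
move=> d; rewrite mem_cat -!dvdn_divisors//; apply/idP/orP => [dpm|[dm|]].
- have [/dvdnP[e de]|pd] := boolP (p %| d)%N.
    right; apply/mapP; exists e; last by rewrite mulnC.
    by rewrite -dvdn_divisors// -(dvdn_pmul2l p0) mulnC -de.
  by left; rewrite -(@Gauss_dvdr d p)// coprime_sym prime_coprime.
- by rewrite dvdn_mull.
- by move=> /mapP[e]; rewrite -dvdn_divisors// => em ->; rewrite dvdn_pmul2l.
Qed.

Lemma squarefree_mul (p m : nat) : prime p -> (0 < m)%N -> ~~ (p %| m)%N ->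
  squarefree (p * m) = squarefree m.
Proof.
move=> pp m0 pm; rewrite /squarefree muln_gt0 prime_gt0// m0 /=.
rewrite (perm_all _ (perm_primes_mul pp m0 pm)) /=.
rewrite expnS expn1 dvdn_pmul2l ?prime_gt0// pm /=.
apply: eq_in_all => q; rewrite mem_primes => /and3P[pq _ qm].
congr (~~ _); apply: Gauss_dvdr; rewrite coprimeXl// prime_coprime//.
by rewrite dvdn_prime2//; apply: contra pm => /eqP <-.
Qed.

(** Euler product, by stripping off the smallest prime factor [p]: the divisors of [p * m] are those
    of [m] and their multiples by [p], so the sum gains the factor [1 + g p]. *)
Lemma sum_divisors_squarefree (A : comNzRingType) (g : nat -> A) (n : nat) :
  g 1%N = 1 ->
  (forall p d, prime p -> (0 < d)%N -> ~~ (p %| d)%N ->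
    g (p * d)%N = g p * g d) ->
  squarefree n ->
  \sum_(d <- divisors n) g d = \prod_(p <- primes n) (1 + g p).
Proof.
move=> g1 gM; elim/ltn_ind: n => n IH sn.
have n0 : (0 < n)%N by case/andP: sn.
have [n1|n1] := leqP n 1.
  have -> : n = 1%N by lia.
  by rewrite big_nil big_cons big_nil g1 addr0.
have pp := pdiv_prime n1; set p := pdiv n in pp.
have /dvdnP[m nE] : (p %| n)%N by exact: pdiv_dvd.
rewrite mulnC in nE.
have m0 : (0 < m)%N by move: n0; rewrite nE muln_gt0 => /andP[].
have pm : ~~ (p %| m)%N.
  case/andP: sn => _ /allP/(_ p); rewrite mem_primes pp n0 pdiv_dvd => /(_ isT).
  by rewrite nE expnS expn1 dvdn_pmul2l// prime_gt0.
have mn : (m < n)%N by rewrite nE ltn_Pmull// prime_gt1.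
have sm : squarefree m by rewrite -(squarefree_mul pp)// -nE.
rewrite nE (perm_big _ (perm_divisors_mul pp m0 pm)) big_cat big_map /=.
rewrite (perm_big _ (perm_primes_mul pp m0 pm)) big_cons -IH//.
rewrite /= mulrDl mul1r mulr_sumr; congr (_ + _).
rewrite !big_seq; apply: eq_bigr => d; rewrite -dvdn_divisors// => dm.
apply: gM => //; first exact: dvdn_gt0 dm.
by apply: contra pm => /dvdn_trans; exact.
Qed.

Lemma sum_moebius (n : nat) : (1 < n)%N -> squarefree n ->
  \sum_(d <- divisors n) moebius d = 0.
Proof.
have mp p d : prime p -> (0 < d)%N -> ~~ (p %| d)%N ->
    moebius (p * d)%N = - moebius d.
  move=> pp d0 pd; rewrite /moebius squarefree_mul// /omega.
  rewrite (perm_size (perm_primes_mul pp d0 pd)) /=.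
  by case: ifP => _; rewrite ?oppr0// exprSr mulrN1.
have m1 : moebius 1 = 1 by [].
have mprime p : prime p -> moebius p = -1.
  by move=> pp; rewrite -(muln1 p) mp ?m1// dvdn1 gtn_eqF// prime_gt1.
move=> n1 sn; rewrite sum_divisors_squarefree//; last first.
  by move=> p d pp d0 pd; rewrite mp// (mprime p)// mulN1r.
(* As [n > 1] there is at least one factor [1 + moebius p], and it vanishes. *)
rewrite (big_rem (pdiv n)) /=; last first.
  by rewrite mem_primes pdiv_prime// pdiv_dvd ltnW.
by rewrite mprime ?pdiv_prime// subrr mul0r.
Qed.

Lemma sum_divisors_powR (R : realType) (n : nat) (s : R) : squarefree n ->
  \sum_(d <- divisors n) d%:R `^ s = \prod_(p <- primes n) (1 + p%:R `^ s).
Proof.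
move=> sn; apply: sum_divisors_squarefree => //; first by rewrite powR1.
by move=> p d _ _ _; rewrite natrM powRM.
Qed.

Lemma prod_primes_squarefree (n : nat) : squarefree n ->
  \prod_(p <- primes n) p = n.
Proof.
move=> sn; have n0 : (0 < n)%N by case/andP: sn.
rewrite [RHS](prod_prime_decomp n0) prime_decompE big_map !big_seq.
apply: eq_bigr => p /[dup] pn; rewrite mem_primes => /and3P[pp _ pdn] /=.
have : (0 < logn p n)%N by rewrite logn_gt0.
suff : (logn p n < 2)%N by case: (logn p n) => [|[|]]//; rewrite expn1.
by case/andP: sn => _ /allP/(_ p pn); rewrite pfactor_dvdn// -ltnNge.
Qed.

(* Rankin's trick on the divisors above [j], which carry the same Moebius sum
   as those up to [j] with the opposite sign. *)
Lemma normM_le (R : realType) (n j : nat) (s : R) :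
  (1 < n)%N -> squarefree n -> (0 < j)%N -> 0 <= s ->
  `|M n (j%:R : R)|%:~R
    <= (n%:R / j%:R) `^ s * \prod_(p <- primes n) (1 + p%:R `^ (- s)) :> R.
Proof.
move=> n1 sn j0 s0.
have j0R : 0 < j%:R :> R by rewrite ltr0n.
have -> : `|M n (j%:R : R)| =
    `|\sum_(d <- divisors n | ~~ (d%:R <= j%:R :> R)) moebius d|.
  have := sum_moebius n1 sn.
  rewrite (bigID (fun d : nat => d%:R <= j%:R :> R)) /= => /eqP.
  by rewrite addr_eq0 => /eqP; rewrite /M => ->; rewrite normrN.
have n0 : (0 < n)%N by exact: ltnW.
(* As [n] is the product of its primes, [n ^ s] turns each factor [1 + p ^ (- s)] into
   [p ^ s + 1]. *)
have -> : (n%:R / j%:R) `^ s * \prod_(p <- primes n) (1 + p%:R `^ (- s)) =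
    \sum_(d <- divisors n) (d%:R / j%:R) `^ s :> R.
  under [RHS]eq_bigr do rewrite powRM//.
  rewrite -big_distrl /= sum_divisors_powR// powRM// mulrAC; congr (_ * _).
  rewrite -[X in X%:R `^ s](prod_primes_squarefree sn) natr_prod.
  have -> : (\prod_(p <- primes n) p%:R) `^ s =
      \prod_(p <- primes n) (p%:R `^ s) :> R.
    elim: (primes n) => [|p r ih]; first by rewrite !big_nil powR1.
    by rewrite !big_cons powRM ?ih// prodr_ge0.
  rewrite -big_split /= !big_seq; apply: eq_bigr => p.
  rewrite mem_primes => /andP[/prime_gt0 p0 _].
  rewrite mulrDr mulr1 powRN mulfV 1?addrC//.
  by rewrite gt_eqF// powR_gt0// ltr0n.
(* Divisors up to [j] contribute nonnegative terms and are dropped; each one above [j] contributes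
   at least 1, hence at least the absolute value of its Moebius term. *)
rewrite [leRHS](bigID (fun d : nat => d%:R <= j%:R :> R)) /=.
apply: (@le_trans _ _ (\sum_(d <- divisors n | ~~ (d%:R <= j%:R :> R)) 1)).
  have -> : \sum_(d <- divisors n | ~~ (d%:R <= j%:R :> R)) 1 =
      (\sum_(d <- divisors n | ~~ (d%:R <= j%:R :> R)) (1 : int))%:~R :> R.
    by rewrite rmorph_sum.
  rewrite ler_int.
  apply: (le_trans (ler_norm_sum _ _ _)); apply: ler_sum => d _.
  by rewrite /moebius; case: ifP => _; rewrite ?normr0// normrX normrN1 expr1n.
apply: ler_wpDl; first by apply: sumr_ge0 => d _; exact: powR_ge0.
apply: ler_sum => d; rewrite -ltNge => /ltW jd.
rewrite -{1}(powRr0 (d%:R / j%:R)); apply: ler_powR => //.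
by rewrite ler_pdivlMr// mul1r.
Qed.

(** * Lower bounds for the k-th prime *)

(** Sliding the window by one drops [x] and gains [x + m], which [P] does not distinguish. *)
Lemma count_iota_periodic (P : pred nat) (m x : nat) :
  (forall y, P (y + m)%N = P y) -> count P (iota x m) = count P (iota 0 m).
Proof.
move=> Pm; elim: x => [//|x <-].
have := congr1 (count P) (iotaD x 1 m).
rewrite (addnC 1%N) iotaD !count_cat /= Pm addn1 !addn0 addnC.
by move/addnI.
Qed.

(** Primes above 5 are coprime to 30, and there are 8 residues coprime to 30. *)
Lemma count_prime_iota30 (x : nat) : (6 <= x)%N ->
  (count prime (iota x 30) <= 8)%N.
Proof.
move=> x6; apply: (@leq_trans (count (coprime 30) (iota x 30))); last first.
  by rewrite count_iota_periodic// => y; rewrite /coprime gcdnDr.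
rewrite -!size_filter; apply: uniq_leq_size.
  by rewrite filter_uniq// iota_uniq.
move=> p; rewrite !mem_filter mem_iota => /andP[pp /andP[xp px]].
rewrite xp px !andbT coprime_sym prime_coprime//.
rewrite (_ : 30 = 2 * 3 * 5)%N// !Euclid_dvdM// !dvdn_prime2//.
by lia.
Qed.

(** Induction in steps of 30. The constant 88 is dictated by [x = 19], where equality holds; from 36
    on, the last window of length 30 contains no prime below 7. *)
Lemma count_prime_le (x : nat) :
  (30 * count prime (iota 0 x.+1) <= 8 * x + 88)%N.
Proof.
elim/ltn_ind: x => x IH; have [x36|x36] := ltnP x 36.
  suff /allP/(_ x) : all
      (fun x => 30 * count prime (iota 0 x.+1) <= 8 * x + 88)%N
      (iota 0 36) by rewrite mem_iota x36; exact.
  by vm_compute.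
have /IH : (x - 30 < x)%N by lia.
have -> : x.+1 = ((x - 30).+1 + 30)%N by lia.
rewrite iotaD count_cat add0n.
have := @count_prime_iota30 (x - 30).+1; lia.
Qed.

(** The first [i + 1] entries of [s] are distinct primes, none exceeding the entry at index [i]. *)
Lemma count_prime_sorted (s : seq nat) (i : nat) :
  sorted ltn s -> all prime s -> (i < size s)%N ->
  (i < count prime (iota 0 (nth 0%N s i).+1))%N.
Proof.
move=> ss sp si; rewrite -size_filter.
have -> : i.+1 = size (take i.+1 s) by rewrite size_takel.
apply: uniq_leq_size.
  by apply: take_uniq; apply: sorted_uniq ss; [exact: ltn_trans|exact: ltnn].
move=> p /(nthP 0%N)[k]; rewrite size_takel// ltnS => ki <-.
rewrite nth_take// mem_filter mem_iota /= add0n ltnS.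
rewrite (allP sp) ?mem_nth ?(leq_ltn_trans ki)//=.
move: ki; rewrite leq_eqVlt => /orP[/eqP->//|ki].
by rewrite ltnW// (sorted_ltn_nth ltn_trans)// inE (ltn_trans ki).
Qed.

(** Writing [q] for the entry, [8 q >= 30 (i + 1) - 88], and [3 (i + 1) >= 88] once
    [i + 1 >= 30]. *)
Lemma nth_prime_ge_linear (s : seq nat) (i : nat) :
  sorted ltn s -> all prime s -> (i < size s)%N -> (29 <= i)%N ->
  (27 * i.+1 <= 8 * nth 0%N s i)%N.
Proof.
move=> ss sp si i29.
have := count_prime_sorted ss sp si.
by have := count_prime_le (nth 0%N s i); lia.
Qed.

(** The 56th prime is 263, so these are the 56 smallest primes. *)
Definition small_primes : seq nat := [seq p <- iota 0 264 | prime p].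

Lemma nth_prime_ge_small (s : seq nat) (i : nat) :
  sorted ltn s -> all prime s -> (i < size s)%N -> (i < 56)%N ->
  (nth 0%N small_primes i <= nth 0%N s i)%N.
Proof.
move=> ss sp si i56; rewrite leqNgt; apply/negP => lt.
have := count_prime_sorted ss sp si.
set q := nth 0%N s i in lt *.
(* An entry below the small prime of index [i] would leave room for at most [i] primes up to it,
   whereas [i + 1] are needed. *)
have /(leq_trans _) H : (count prime (iota 0 q.+1) <=
    count prime (iota 0 (nth 0%N small_primes i)))%N.
  by rewrite -(subnKC lt) iotaD count_cat leq_addr.
move/H; rewrite ltnNge; apply/negP; rewrite negbK.
suff /allP/(_ i) : all
    (fun i => count prime (iota 0 (nth 0%N small_primes i)) <= i)%N (iota 0 56).
  by rewrite mem_iota i56; exact.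
by vm_compute.
Qed.

(** * Sums of negative powers of primes *)

(** The concavity bound at [k / (k + 1)], scaled by [(k + 1) ^ s]. It lets sums of powers be
    compared with telescoping ones. *)
Lemma powRS_sub_ge (R : realType) (k : nat) (s : R) : 0 < s -> s <= 1 ->
  s * k.+1%:R `^ (s - 1) <= k.+1%:R `^ s - k%:R `^ s.
Proof.
move=> s0 s1; have k0 : 0 < k.+1%:R :> R by rewrite ltr0n.
have := @powR_le_affine R (k%:R / k.+1%:R) s.
rewrite divr_ge0// ltW// s1 => /(_ isT isT isT) h.
have -> : k%:R `^ s = k.+1%:R `^ s * (k%:R / k.+1%:R) `^ s.
  by rewrite -powRM ?divr_ge0// ?ltW// mulrCA mulfV ?mulr1// gt_eqF.
have -> : k.+1%:R `^ (s - 1) = k.+1%:R `^ s / k.+1%:R :> R.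
  by rewrite powRB ?(gt_eqF k0) ?implybT// powRr1// ltW.
have e : k%:R / k.+1%:R - 1 = - (k.+1%:R)^-1 :> R.
  by rewrite -[X in _ - X](@mulfV _ k.+1%:R) ?gt_eqF// -mulrBl -natr1; ring.
rewrite e in h.
have := ler_wpM2l (powR_ge0 k.+1%:R s) h.
move: (k.+1%:R `^ s) (_ `^ s) (k.+1%:R^-1) => x y z; lra.
Qed.

(** Each term is bounded by a fraction of denominator 200, checked after cubing. The numerators add
    up to 2905, and [(2905 / 200) ^ 3 <= 56 ^ 2]. *)
Lemma sum_powR_primes_third_small (R : realType) :
  \sum_(i < 56) (nth 0%N small_primes i)%:R `^ (- 3^-1) <= 56 `^ (2 / 3) :> R.
Proof.
have root (p a : nat) : (0 < p)%N -> 0 <= a%:R :> R ->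
    200 ^+ 3 <= a%:R ^+ 3 * p%:R :> R -> p%:R `^ (- 3^-1) <= a%:R / 200 :> R.
  move=> p0 a0 h; have p0R : 0 < p%:R :> R by rewrite ltr0n.
  have x0 : 0 <= a%:R / 200 :> R by lra.
  have -> : a%:R / 200 = ((a%:R / 200) ^+ 3) `^ (3^-1) :> R.
    by rewrite -powR_mulrn// -powRrM mulfV// powRr1.
  rewrite -mulN1r powRrM powR_inv1 ?(ltW p0R)//.
  apply: ge0_ler_powR; rewrite ?nnegrE ?invr_ge0 ?exprn_ge0// ?(ltW p0R)//.
  rewrite -div1r ler_pdivrMr//; lra.
(* [a] is the least integer with [p `^ (- 3^-1) <= a / 200]. *)
pose roots : seq nat :=
    [:: 159; 139; 117; 105; 90; 86; 78; 75; 71; 66; 64; 61; 59; 58; 56; 54;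
        52; 51; 50; 49; 48; 47; 46; 45; 44; 43; 43; 43; 42; 42; 40; 40; 39;
        39; 38; 38; 38; 37; 37; 36; 36; 36; 35; 35; 35; 35; 34; 33; 33; 33;
        33; 33; 33; 32; 32; 32].
have -> : \sum_(i < 56) (nth 0%N small_primes i)%:R `^ (- 3^-1) =
    \sum_(p <- small_primes) p%:R `^ (- 3^-1) :> R.
  by rewrite (big_nth 0%N) big_mkord.
apply: (@le_trans _ _ (\sum_(a <- roots) a%:R / 200)).
  have -> : small_primes =
    [:: 2; 3; 5; 7; 11; 13; 17; 19; 23; 29; 31; 37; 41; 43; 47; 53; 59; 61;
        67; 71; 73; 79; 83; 89; 97; 101; 103; 107; 109; 113; 127; 131; 137;
        139; 149; 151; 157; 163; 167; 173; 179; 181; 191; 193; 197; 199; 211;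
        223; 227; 229; 233; 239; 241; 251; 257; 263].
    by vm_compute.
  rewrite /roots !big_cons !big_nil.
  by do 56! [apply: lerD; first by apply: root; [exact: isT|exact: ler0n|lra]].
have -> : 56 `^ (2 / 3) = (56 ^+ 2) `^ (3^-1) :> R.
  by rewrite -(powR_mulrn 2)// -powRrM.
have -> : \sum_(a <- roots) a%:R / 200 = (2905 / 200) :> R.
  by rewrite /roots !big_cons big_nil; lra.
have -> : 2905 / 200 = ((2905 / 200) ^+ 3) `^ (3^-1) :> R.
  have x0 : 0 <= 2905 / 200 :> R by lra.
  by rewrite -(powR_mulrn _ x0) -powRrM mulfV// (powRr1 x0).
by apply: ge0_ler_powR; rewrite ?nnegrE; lra.
Qed.

Lemma sum_powR_primes_third (R : realType) (s : seq nat) (k : nat) :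
  sorted ltn s -> all prime s -> (56 <= k)%N -> (k <= size s)%N ->
  \sum_(i < k) (nth 0%N s i)%:R `^ (- 3^-1) <= k%:R `^ (2 / 3) :> R.
Proof.
move=> ss sp k56 ks; rewrite -(subnKC k56) in ks *.
elim: (k - 56)%N ks => [|j IH] ks.
  rewrite addn0 in ks *; apply: le_trans (sum_powR_primes_third_small R).
  apply: ler_sum => i _.
  have i_s : (i < size s)%N by exact: leq_trans (ltn_ord i) _.
  have h := nth_prime_ge_small ss sp i_s (ltn_ord i).
  have p0 : (0 < nth 0%N small_primes i)%N.
    have : (i < size small_primes)%N by rewrite (_ : size _ = 56).
    by move=> /(mem_nth 0%N); rewrite mem_filter => /andP[/prime_gt0].
  rewrite !powRN lef_pV2 ?posrE ?powR_gt0 ?ltr0n ?(leq_trans p0 h)//.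
  by apply: ge0_ler_powR; rewrite ?nnegrE ?invr_ge0// ler_nat.
rewrite addnS big_ord_recr /=.
have m29 : (29 <= 56 + j)%N by exact: leq_trans (leq_addr j 56).
rewrite addnS in ks; have {IH} := IH (ltnW ks).
move: (56 + j)%N m29 ks => m m29 ks.
have := @powRS_sub_ge R m (2 / 3).
have -> : 0 < 2 / 3 :> R by lra.
have -> : 2 / 3 <= 1 :> R by lra.
move=> /(_ isT isT); have -> : 2 / 3 - 1 = - 3^-1 :> R by lra.
(* The right side bounds the growth of [k ^ (2 / 3)] from below. As [2 / 3 = (27 / 8) ^ (- 1 / 3)],
   it suffices that the new prime is at least [27 / 8 * (m + 1)]. *)
suff : (nth 0%N s m)%:R `^ (- 3^-1) <= 2 / 3 * m.+1%:R `^ (- 3^-1) :> R by lra.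
have h := nth_prime_ge_linear ss sp ks m29.
have -> : 2 / 3 = (27 / 8) `^ (- 3^-1) :> R.
  have -> : 27 / 8 = (3 / 2) `^ 3 :> R by rewrite (powR_mulrn 3)//; lra.
  by rewrite -powRrM mulrN mulfV// powR_inv1// invf_div.
have m0 : 0 < m.+1%:R :> R by rewrite ltr0n.
rewrite -powRM//.
have h' : 27 / 8 * m.+1%:R <= (nth 0%N s m)%:R :> R.
  move: h; rewrite -(ler_nat R) !natrM; lra.
have q0 : 0 < (nth 0%N s m)%:R :> R by apply: lt_le_trans h'; rewrite mulr_gt0.
rewrite !powRN lef_pV2 ?posrE ?powR_gt0 ?mulr_gt0//.
by apply: ge0_ler_powR; rewrite ?nnegrE ?invr_ge0 ?(ltW q0)// mulr_ge0// ltW.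
Qed.

Lemma sum_powR_primes_le (R : realType) (s : seq nat) (x : R) :
  sorted ltn s -> all prime s -> (56 <= size s)%N -> 0 <= x -> x <= 3^-1 ->
  \sum_(p <- s) p%:R `^ (- x) <= (size s)%:R `^ (1 - x).
Proof.
move=> ss sp s56 x0 x3; set w : R := (size s)%:R.
have w0 : 0 < w by rewrite ltr0n; lia.
rewrite (powRB _ (s := x)) ?(gt_eqF w0) ?implybT// powRr1 ?(ltW w0)//.
rewrite mulrC -powRN.
(* By concavity of [t `^ (3 * x)], the term [(w / p) `^ x] lies below its chord
   between the exponents [0] and [3^-1]. *)
have term (p : nat) : (0 < p)%N -> p%:R `^ (- x) <=
    w `^ (- x) * (1 - 3 * x)
    + w `^ (- x) * (3 * x) * w `^ (3^-1) * p%:R `^ (- 3^-1).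
  move=> p0; have p0R : 0 < p%:R :> R by rewrite ltr0n.
  have -> : p%:R `^ (- x) = w `^ (- x) * ((w / p%:R) `^ (3^-1)) `^ (3 * x).
    rewrite -powRrM mulrA mulVf// mul1r powRM ?invr_ge0 ?(ltW w0) ?(ltW p0R)//.
    rewrite mulrA -powRD ?(gt_eqF w0) ?implybT// addNr powRr0 mul1r.
    by rewrite -powR_inv1 ?(ltW p0R)// -powRrM mulN1r.
  have -> : p%:R `^ (- 3^-1) = (p%:R^-1) `^ (3^-1) :> R.
    by rewrite -mulN1r powRrM powR_inv1 ?(ltW p0R).
  rewrite -(mulrA _ (w `^ _)) -powRM ?invr_ge0 ?(ltW w0) ?(ltW p0R)//.
  rewrite -mulrA -mulrDr; apply: ler_wpM2l; first exact: powR_ge0.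
  apply: le_trans (powR_le_affine _ _ _) _; [exact: powR_ge0|lra|lra|].
  lra.
apply: (@le_trans _ _ (\sum_(p <- s) (w `^ (- x) * (1 - 3 * x)
    + w `^ (- x) * (3 * x) * w `^ (3^-1) * p%:R `^ (- 3^-1)))).
  rewrite !big_seq; apply: ler_sum => p /(allP sp)/prime_gt0; exact: term.
rewrite big_split /= -[X in _ + X <= _]mulr_sumr.
rewrite big_const_seq count_predT iter_addr addr0.
have := @sum_powR_primes_third R s (size s) ss sp s56 (leqnn _).
have <- : \sum_(p <- s) p%:R `^ (- 3^-1) =
    \sum_(i < size s) (nth 0%N s i)%:R `^ (- 3^-1) :> R.
  by rewrite (big_nth 0%N) big_mkord.
move: (\sum_(p <- s) _) => S hS.
(* That is, the mean of [(w / p) ^ (1 / 3)] is at most 1, so the chord has mean at most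
   [(1 - 3 x) + 3 x = 1]. *)
have h1 : w `^ (3^-1) * S <= w.
  apply: le_trans (ler_wpM2l (powR_ge0 _ _) hS) _.
  rewrite -powRD ?(gt_eqF w0) ?implybT//.
  by rewrite (_ : 3^-1 + 2 / 3 = 1) ?powRr1 ?(ltW w0)//; lra.
rewrite -[_ *+ size s]mulr_natr -/w.
have h2 : 0 <= w `^ (- x) * (3 * x) by rewrite mulr_ge0 ?powR_ge0//; lra.
have := ler_wpM2l h2 h1; move: (w `^ _) (w `^ _) => u v; lra.
Qed.

Lemma sum_powR_primes_le_div (R : realType) (s : seq nat) (x : R) :
  sorted ltn s -> all prime s -> 0 <= x -> x < 1 ->
  \sum_(p <- s) p%:R `^ (- x) <= (size s)%:R `^ (1 - x) / (1 - x).
Proof.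
move=> ss sp x0 x1; rewrite (big_nth 0%N) big_mkord ler_pdivlMr ?subr_gt0//.
rewrite mulrC mulr_sumr.
apply: (@le_trans _ _ (\sum_(i < size s)
    (i.+1%:R `^ (1 - x) - i%:R `^ (1 - x)))); last first.
  rewrite -(big_mkord xpredT (fun i => i.+1%:R `^ (1 - x) - i%:R `^ (1 - x))).
  by rewrite telescope_sumr// powR0 ?subr0//; lra.
apply: ler_sum => i _.
apply: le_trans (@powRS_sub_ge R i (1 - x) _ _); [|lra|lra].
apply: ler_wpM2l; first lra.
rewrite (_ : 1 - x - 1 = - x); last by ring.
(* As 0 is not prime, the number of primes up to an entry is at most that entry, without an extra
   1. *)
have iq : (i < nth 0%N s i)%N.
  apply: leq_trans (count_prime_sorted ss sp (ltn_ord i)) _.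
  by rewrite /= add0n; apply: leq_trans (count_size _ _) _; rewrite size_iota.
rewrite !powRN lef_pV2 ?posrE ?powR_gt0 ?ltr0n ?(leq_ltn_trans _ iq)//.
by apply: ge0_ler_powR; rewrite ?nnegrE// ler_nat.
Qed.

(** * From the sum over primes to the bound on [calH] *)

Lemma prod_powR_le_expR (R : realType) (s : seq nat) (x : R) :
  \prod_(p <- s) (1 + p%:R `^ x) <= expR (\sum_(p <- s) p%:R `^ x).
Proof.
elim: s => [|p s IH]; first by rewrite !big_nil expR0.
rewrite !big_cons expRD; apply: ler_pM => //.
- by apply: prodr_ge0 => q _; rewrite addr_ge0 ?powR_ge0.
- exact: expR_ge1Dx.
Qed.

(** The integers counted all lie in [[1, B]], so a bound for each of them also bounds their
    number. *)
Lemma calH_le (R : realType) (theta : R) (n : nat) (B : R) : 0 <= B ->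
  (forall j : nat, (0 < j)%N ->
    2 `^ (theta * (omega n)%:R) <= `|M n (j%:R : R)|%:~R -> j%:R <= B) ->
  (calH theta n)%:R <= B.
Proof.
move=> B0 h; apply: le_trans (_ : (Num.truncn B)%:R <= _); last first.
  by rewrite truncn_le.
rewrite ler_nat /calH cardE -(size_map val) -(size_iota 1 (Num.truncn B)).
apply: uniq_leq_size.
  by rewrite map_inj_uniq ?enum_uniq//; exact: val_inj.
move=> _ /mapP[j + ->]; rewrite mem_enum inE => /andP[j1 hj].
rewrite mem_iota j1 /= add1n ltnS.
by rewrite truncn_ge_nat// h.
Qed.

(** From [exp (- 7 / 32) >= 25 / 32], the 16th power gives [exp (7 / 2) <= (32 / 25) ^ 16], which is
    below 56. *)
Lemma expR_7div2_le56 (R : realType) : expR (7 / 2) <= 56 :> R.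
Proof.
have h : 25 / 32 <= expR (- (7 / 32)) :> R.
  by apply: le_trans (expR_ge1Dx _); lra.
have : (25 / 32) ^+ 16 <= expR (- (7 / 32)) ^+ 16 :> R.
  by apply: lerXn2r h; rewrite nnegrE ?expR_ge0//; lra.
rewrite -expRM_natr (_ : - (7 / 32) * 16 = - (7 / 2)); last by lra.
rewrite expRN => h16.
have e0 : 0 < expR (7 / 2) :> R by exact: expR_gt0.
have : (25 / 32) ^+ 16 * expR (7 / 2) <= 1 :> R by rewrite -ler_pdivlMr// div1r.
lra.
Qed.

Lemma sum_powR_primes_le_main_add_error (R : realType) (s : seq nat) (c : R) :
  sorted ltn s -> all prime s -> (56 <= size s)%N ->
  let w : R := (size s)%:R in
  0 < c -> c < ln w ->
  \sum_(p <- s) p%:R `^ (- (c / ln w)) <=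
    w * expR (- c) + c / ln w * ((c / (1 - c / ln w)) ^+ 3
      * (w / (expR (c / (1 + c / ln w)) * ln w))).
Proof.
move=> ss sp s56 w c0 cL; have w0 : 0 < w by rewrite ltr0n; lia.
have L7 : 7 / 2 <= ln w.
  rewrite -[leLHS]expRK ler_ln ?posrE ?expR_gt0//.
  by apply: le_trans (expR_7div2_le56 R) _; rewrite ler_nat.
have L0 : 0 < ln w by lra.
set x := c / ln w.
have x0 : 0 < x by rewrite divr_gt0.
have x1 : x < 1 by rewrite ltr_pdivrMr// mul1r.
have cE : c = x * ln w by rewrite divfK// gt_eqF.
have wx : w * expR (- c) = w `^ (1 - x).
  rewrite /powR (gt_eqF w0) mulrBl mul1r expRD lnK ?posrE//.
  by rewrite cE.
have [x3|x3] := leP x 3^-1.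
  apply: ler_wpDr; last by rewrite wx; exact: sum_powR_primes_le (ltW x0) x3.
  apply: mulr_ge0; first exact: ltW.
  apply: mulr_ge0; first by rewrite exprn_ge0// divr_ge0; lra.
  by rewrite divr_ge0 ?mulr_ge0 ?expR_ge0//; exact: ltW.
apply: le_trans (sum_powR_primes_le_div ss sp (ltW x0) x1) _.
rewrite -/w -wx; set e := expR (- c); set f := expR (c / (1 + x)).
have ef : e <= f^-1.
  rewrite /e /f -expRN ler_expR lerN2 ler_pdivrMr; last by lra.
  by rewrite ler_peMr; lra.
have f0 : 0 < f^-1 by rewrite invr_gt0 expR_gt0.
have d0 : 0 < 1 - x by lra.
have -> : x * ((c / (1 - x)) ^+ 3 * (w / (f * ln w))) =
    (x ^+ 4 * ln w ^+ 2 * (1 - x) ^- 3) * (w * f^-1).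
  rewrite cE; field.
  by rewrite !gt_eqF// expR_gt0.
have we : w * e <= w * f^-1 by rewrite ler_pM2l.
(* This amounts to [(1 - x) ^ 2 <= x ^ 3 * L ^ 2] with [L = ln w]. The worst case [x = 1 / 3],
   [L = 7 / 2] reads [4 / 9 <= 49 / 108]. *)
have k : x * (1 - x)^-1 <= x ^+ 4 * ln w ^+ 2 * (1 - x) ^- 3.
  rewrite ler_pdivlMr ?exprn_gt0//.
  have -> : x * (1 - x)^-1 * (1 - x) ^+ 3 = x * (1 - x) ^+ 2.
    by field; rewrite gt_eqF.
  rewrite [x ^+ 4]exprS -mulrA ler_pM2l//.
  have a1 : (1 - x) ^+ 2 <= (2 / 3) ^+ 2.
    by apply: lerXn2r; rewrite ?nnegrE; lra.
  have a2 : (3^-1) ^+ 3 <= x ^+ 3 by apply: lerXn2r; rewrite ?nnegrE; lra.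
  have a3 : (7 / 2) ^+ 2 <= ln w ^+ 2 by apply: lerXn2r; rewrite ?nnegrE; lra.
  have a4 := ler_pM _ _ a2 a3.
  apply: le_trans a1 (le_trans _ (a4 _ _)); lra.
(* The first summand is the main term; the second is the excess that the error term absorbs. *)
have -> : w * e / (1 - x) = w * e + (x * (1 - x)^-1) * (w * e).
  by field; rewrite gt_eqF.
rewrite lerD2l; apply: ler_pM => //.
  by rewrite mulr_ge0 ?invr_ge0 ?(ltW x0) ?(ltW d0).
by rewrite mulr_ge0 ?expR_ge0 ?(ltW w0).
Qed.

Theorem corollary1p3 (R : realType) (theta : R) (n : nat) :
  0 < theta -> theta <= 1 ->
  (2 <= n)%N -> squarefree n ->
  let alpha : R := W (expR 1 / (theta * ln 2)) in
  let w : R := (omega n)%:R in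
  alpha - 1 < ln w ->
  (56 <= omega n)%N ->
  (calH theta n)%:R <=
    n%:R * expR (- (theta * ln 2 / alpha) * w * ln w
      + ((alpha - 1) / (1 - (alpha - 1) / ln w)) ^+ 3
        * (w / (expR ((alpha - 1) / (1 + (alpha - 1) / ln w)) * ln w))).
Proof.
move=> theta0 theta1 n2 sn alpha w aL w56.
set E := _ ^+ 3 * _; set c := alpha - 1 in aL E *.
set T := theta * ln 2 in alpha c aL E *.
have ln20 : 0 < ln 2 :> R by rewrite ln_gt0// ltr1n.
have ln21 : ln 2 < 1 :> R.
  rewrite -ltr_expR lnK ?posrE//.
  by have := @expR_gt1Dx R 1; rewrite oner_eq0 => /(_ isT); lra.
have T0 : 0 < T by rewrite mulr_gt0.
have T1 : T < 1 by rewrite /T; nra.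
(* This places the argument of [W] in the range where its defining equation is available. *)
have eT : expR 1 <= expR 1 / T.
  by rewrite ler_pdivlMr// ler_piMr ?expR_ge0// ltW.
have a1 : 1 <= alpha by exact: W_ge1.
have a0 : 0 < alpha by lra.
have aT : T / alpha = expR (- c).
  rewrite (_ : - c = 1 - alpha) ?expRD ?expRN; last by rewrite /c; ring.
  have := W_eq eT; rewrite -/alpha => h.
  have -> : expR alpha = expR 1 / T * alpha by rewrite -h divfK// gt_eqF.
  by field; rewrite !gt_eqF// expR_gt0.
have TE : T = expR (- c) * (1 + c).
  by rewrite -aT /c addrC subrK divfK// gt_eqF.
(* If [c = 0] then [T = 1], but [T <= ln 2 < 1]. Strictness matters since the final inequality is
   divided by [x = c / ln w]. *)
have c0 : 0 < c.
  rewrite lt_neqAle subr_ge0 a1 andbT eq_sym; apply/eqP => c0.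
  by move: TE T1; rewrite c0 oppr0 expR0; lra.
have L0 : 0 < ln w by lra.
have n0 : 0 < n%:R :> R by rewrite ltr0n ltnW.
apply: calH_le => [|j j0 hj]; first by rewrite mulr_ge0 ?expR_ge0// ltW.
have j0R : 0 < j%:R :> R by rewrite ltr0n.
(* This Rankin exponent makes [w ^ (- x) = exp (- c) = T / alpha]. *)
set x := c / ln w; have x0 : 0 < x by rewrite divr_gt0.
have sp : all prime (primes n).
  by apply/allP => p; rewrite mem_primes => /andP[].
have hS := sum_powR_primes_le_main_add_error (sorted_primes n) sp w56 c0 aL.
rewrite -/(omega n) -/w -/x -/E in hS.
have := le_trans hj (normM_le n2 sn j0 (ltW x0)).
move=> /le_trans/(_ (ler_wpM2l (powR_ge0 _ _) (prod_powR_le_expR _ _))).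
rewrite /powR (@gt_eqF _ _ 2)// (@gt_eqF _ _ (_ / _)) ?divr_gt0//.
rewrite -expRD ler_expR ln_div ?posrE// -/w => hT.
have {}hT := le_trans hT (lerD (lexx _) hS).
rewrite -ler_ln ?posrE ?mulr_gt0 ?expR_gt0// lnM ?posrE ?expR_gt0// expRK aT.
rewrite -(ler_pM2l x0).
have xL : x * ln w = c by rewrite divfK// gt_eqF.
(* The first part cancels the main term of the sum over primes; the second, divided by [x], is the
   saving [exp (- c) * w * ln w] in the exponent. *)
have Tw : theta * w * ln 2 = expR (- c) * w + c * (expR (- c) * w).
  by rewrite mulrAC -/T TE; ring.
rewrite Tw in hT.
have -> : x * (ln n%:R + (- expR (- c) * w * ln w + E)) =
   x * ln n%:R - x * ln w * (expR (- c) * w) + x * E by ring.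
by rewrite xL; lra.
Qed.
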